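(* Let $n$ be a positive integer and let $d=\sqrt n$. Let $J_n$ be the symmetric matrix $$J_n=\begin{bmatrix}-2&2&2&2\\2&-2&2&2\\2&2&-2&4n-2\\2&2&4n-2&-2\end{bmatrix}$$ (that is, with off-diagonal entry $a=4d^2-2=4n-2$ in positions $(3,4)$ and $(4,3)$), and let $\Lambda_n=\mathbf e_1\mathbb Z\oplus\mathbf e_2\mathbb Z\oplus\mathbf e_3\mathbb Z\oplus\mathbf e_4\mathbb Z\subset\mathbb R^{1,3}$ be the lattice generated by $\mathbf e_1,\dots,\mathbf e_4$ with $[\mathbf e_i\cdot\mathbf e_j]=J_n$. Let $D\in\mathbb R^{1,3}$ be such that $D\cdot D>0$ and $D\cdot\mathbf v\neq0$ for all $\mathbf v\in\Lambda_n$ with $\mathbf v\cdot\mathbf v=-2$, and let $\mathcal E_{-2}^*$ be the set defined from $\Lambda_n$ and $D$ (see context). Then $\mathcal E_{-2}^*$ is a maximal circle packing.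
   Context: $\mathbb R^{1,3}$ is the space of real $4$-tuples with the symmetric bilinear form $\mathbf u\cdot\mathbf v=\mathbf u^TJ\mathbf v$, where $J$ is a symmetric matrix of signature $(1,3)$ (one positive and three negative eigenvalues); here $J=J_n$ in the basis $\mathbf e_1,\dots,\mathbf e_4$. With $D$ fixed, $\mathcal H=\{\mathbf x\in\mathbb R^{1,3}:\mathbf x\cdot\mathbf x=1,\ \mathbf x\cdot D>0\}$ is a model of hyperbolic space $\mathbb H^3$, with distance given by $\cosh(|AB|)=A\cdot B$. For $\mathbf v$ with $\mathbf v\cdot\mathbf v<0$, $H_{\mathbf v}$ denotes the hyperplane $\{\mathbf x:\mathbf v\cdot\mathbf x=0\}$ (and also its intersection with $\mathcal H$, a hyperbolic plane, whose boundary at infinity is a circle or line), and $H_{\mathbf v}^+=\{\mathbf x:\mathbf v\cdot\mathbf x\ge0\}$. Define $$\mathcal E_{-2}=\{\mathbf v\in\Lambda_n:\mathbf v\cdot\mathbf v=-2,\ \mathbf v\cdot D>0\},\qquad \mathcal K_{-2}=\bigcap_{\mathbf v\in\mathcal E_{-2}}H_{\mathbf v}^+,$$ $$\mathcal E_{-2}^*=\{\mathbf v\in\mathcal E_{-2}: H_{\mathbf v}\text{ is a face of }\mathcal K_{-2}\},$$ where ''$H_{\mathbf v}$ is a face of $\mathcal K_{-2}$'' means a codimension-one face: $H_{\mathbf v}\cap\mathcal K_{-2}\cap\mathcal H$ has nonempty interior relative to the plane $H_{\mathbf v}\cap\mathcal H$. A set $\mathcal P\subset\mathbb R^{1,3}$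 is a (circle) packing if there is a $k>0$ such that $\mathbf v\cdot\mathbf v=-k$ for all $\mathbf v\in\mathcal P$ and $\mathbf v\cdot\mathbf v'\ge k$ for all distinct $\mathbf v,\mathbf v'\in\mathcal P$ (trivial packings of the form $\{\mathbf v,-\mathbf v\}$ are ignored). A packing $\mathcal P$ is maximal if no vector can be added to $\mathcal P$ so that the result is still a packing, i.e. there is no $\mathbf m\in\mathbb R^{1,3}\setminus\mathcal P$ such that $\mathcal P\cup\{\mathbf m\}$ is a packing. *)

(* Defs.v *)
From HB Require Import structures.
From mathcomp Require Import all_boot all_order all_algebra.
From mathcomp Require Import all_classical all_reals all_analysis.
Import Order.TTheory GRing.Theory Num.Theory.
Import numFieldNormedType.Exports.

Set Implicit Arguments.
Unset Strict Implicit.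
Unset Printing Implicit Defensive.

Local Open Scope classical_set_scope.
Local Open Scope ring_scope.

(* Vectors of R^{1,3} are column vectors of coordinates in the basis
   e_1, ..., e_4, in which the bilinear form has Gram matrix J. *)

Definition mform (R : realType) (J : 'M[R]_4) (u v : 'cV[R]_4) : R :=
  (u^T *m J *m v) 0 0.

Definition Jmx (R : realType) (n : nat) : 'M[R]_4 :=
  let a : R := 4 * n%:R - 2 in
  \matrix_(i, j)
    nth 0 (nth [::] [:: [:: -2;  2;  2;  2];
                        [::  2; -2;  2;  2];
                        [::  2;  2; -2;  a];
                        [::  2;  2;  a; -2] ] i) j.

Definition intlattice (R : realType) : set 'cV[R]_4 :=
  range (fun z : 'cV[int]_4 => map_mx intr z).

Section Hyperbolic.
Variables (R : realType) (J : 'M[R]_4) (D : 'cV[R]_4).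

Definition hyperboloid : set 'cV[R]_4 :=
  [set x | mform J x x = 1 /\ 0 < mform J x D].

Definition hplane (v : 'cV[R]_4) : set 'cV[R]_4 := [set x | mform J v x = 0].

Definition hspace (v : 'cV[R]_4) : set 'cV[R]_4 := [set x | 0 <= mform J v x].

Definition E2 : set 'cV[R]_4 :=
  [set v | [/\ intlattice v, mform J v v = -2 & 0 < mform J v D]].

Definition K2 : set 'cV[R]_4 := \bigcap_(v in E2) hspace v.

(* The interior of S in the subspace topology of A; the topology that the
   hyperbolic metric induces on the hyperboloid is the one inherited from
   R^4. *)
Definition rel_interior (A S : set 'cV[R]_4) : set 'cV[R]_4 :=
  [set x | A x /\ within A (nbhs x) S].

Definition is_face (v : 'cV[R]_4) : Prop :=
  rel_interior (hplane v `&` hyperboloid) (hplane v `&` K2 `&` hyperboloid)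
  !=set0.

Definition E2star : set 'cV[R]_4 := [set v | E2 v /\ is_face v].

End Hyperbolic.

Section Packing.
Variables (R : realType) (J : 'M[R]_4).

(* The last clause discards the trivial packings {v, -v}. *)
Definition is_packing (P : set 'cV[R]_4) : Prop :=
  (exists k : R,
     [/\ 0 < k,
         forall v, P v -> mform J v v = - k &
         forall v v', P v -> P v' -> v <> v' -> k <= mform J v v']) /\
  ~ (exists v, P = [set v; - v]).

Definition is_maximal_packing (P : set 'cV[R]_4) : Prop :=
  is_packing P /\ forall m, ~ P m -> ~ is_packing (P `|` [set m]).

End Packing.

(* Main.v *)
Require Import Defs.
From mathcomp Require Import all_boot all_order all_algebra.
From mathcomp Require Import all_classical all_reals all_analysis.
From mathcomp Require Import ring lra zify.
Import Order.TTheory GRing.Theory Num.Theory.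
Import numFieldNormedType.Exports.
Local Open Scope classical_set_scope.
Local Open Scope ring_scope.

(** Write u.v for the form. Three facts about the lattice carry the proof.

    - The form has signature (1,3) ([Jmx_lorentzian]): a vector orthogonal to a
      timelike vector and of norm at least 0 is zero. Every statement about
      light cones that is needed follows from this: a nonzero vector of norm at
      least 0 keeps its sign on a sheet of timelike vectors ([cone_transfer]), and two
      such vectors with positive product lie in the same cone
      ([cone_transfer_dual]).

    - All entries of J/2 are odd, so u.v/2 is congruent modulo 2 to the product
      of the coordinate sums of u and v. A root (a lattice vector of norm -2)
      has odd coordinate sum, whence the product of two roots is 2 modulo 4 and
      is never strictly between -2 and 2 ([Jmx_noncrossing]). So two distinct
      root planes never cross inside hyperbolic space.

    - Root planes cross every open half space ([Jmx_roots_cross]). Rational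
      points are dense on the light cone, so an open half space contains an
      isotropic lattice vector c at infinity. Unipotent lattice isometries
      fixing c (Eichler transvections) drag every point towards c, hence also
      drag some root plane, together with points on both of its sides, into the
      half space.

    Since root planes do not cross, a root plane that separates D from a point x
    and is nearest to D among those is entirely a wall of K_{-2}
    ([nearest_root_wall]); nearest means that v.D is minimal, and the minimum
    is attained because only finitely many roots have v.D bounded. Hence every
    point outside K_{-2} is cut off by a face ([exists_face]). Two faces v and
    w satisfy v.w >= 2, because v.w <= -2 would nest their half spaces, and the
    outer wall would miss K_{-2} ([faces_separated]).

    For maximality let m have norm -2 and m.v >= 2 for all faces v. By the third
    fact some x has m.x < 0 and v.x < 0 for a face v, and likewise there is a
    second face w. All the sums of two of m, v, w have norm at least 0, and
    v + w is future directed with (v + w).(m + v) > 0, so m + v is future directed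
    too; this contradicts (m + v).x < 0. *)

(** * The bilinear form *)

Section Bilinear.
Context {R : realType} {J : 'M[R]_4}.
Implicit Types u v w : 'cV[R]_4.
Local Notation "u .* v" := (mform J u v) (at level 40).

Lemma mformDl u v w : (u + v) .* w = u .* w + v .* w.
Proof. by rewrite /mform linearD /= !mulmxDl mxE. Qed.

Lemma mformDr u v w : w .* (u + v) = w .* u + w .* v.
Proof. by rewrite /mform mulmxDr mxE. Qed.

Lemma mformZl a u v : (a *: u) .* v = a * (u .* v).
Proof. by rewrite /mform linearZ /= -!scalemxAl mxE. Qed.

Lemma mformZr a u v : u .* (a *: v) = a * (u .* v).
Proof. by rewrite /mform -scalemxAr mxE. Qed.

Lemma mformNl u v : (- u) .* v = - (u .* v).
Proof. by rewrite -scaleN1r mformZl mulN1r. Qed.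

Lemma mformNr u v : u .* (- v) = - (u .* v).
Proof. by rewrite -scaleN1r mformZr mulN1r. Qed.

Lemma mform0l u : 0 .* u = 0.
Proof. by rewrite -(scale0r u) mformZl mul0r. Qed.

Lemma mform0r u : u .* 0 = 0.
Proof. by rewrite -(scale0r u) mformZr mul0r. Qed.

Lemma mformC u v : J^T = J -> u .* v = v .* u.
Proof.
move=> symJ; have -> : v .* u = (v^T *m J *m u)^T 0 0 by rewrite mxE.
by rewrite !trmx_mul trmxK symJ mulmxA.
Qed.

End Bilinear.

Definition mformE :=
  (@mformDl, @mformDr, @mformZl, @mformZr, @mformNl, @mformNr).

(** Signature (1,3), in the one form in which it is used: the orthogonal
    complement of a timelike vector is negative definite. *)
Definition lorentzian {R : realType} (J : 'M[R]_4) : Prop :=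
  forall p x, 0 < mform J p p -> mform J p x = 0 -> 0 <= mform J x x -> x = 0.

Section Lorentzian.
Context {R : realType} {J : 'M[R]_4}.
Hypotheses (symJ : J^T = J) (lorJ : lorentzian J).
Implicit Types u v w x y p : 'cV[R]_4.
Local Notation "u .* v" := (mform J u v) (at level 40).

(** The combination [z] of [p] and [y] that is orthogonal to [w] would be
    timelike if [w] took opposite signs at [p] and [y]; then [w] would be zero. *)
Lemma cone_transfer p y w : 0 < p .* p -> 0 < y .* y -> 0 < p .* y ->
  0 <= w .* w -> 0 < w .* p -> 0 < w .* y.
Proof.
move=> pp yy py ww wp; rewrite ltNge; apply/negP => wy.
have z0 : w = 0.
  apply: (lorJ ((w .* p) *: y - (w .* y) *: p)) => //; last first.
    by rewrite !mformE (mformC _ w) // (mformC _ w symJ); ring.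
  have h1 := mulr_gt0 (exprn_gt0 2 wp) yy.
  have h2 := mulr_ge0 (sqr_ge0 (w .* y)) (ltW pp).
  have h3 := mulr_le0_ge0 wy (mulr_ge0 (ltW wp) (ltW py)).
  rewrite !mformE (mformC y p) //; lra.
by move: wp; rewrite z0 mform0l ltxx.
Qed.

(** The combination of [u] and [w] orthogonal to [p] has norm at least 0 if
    [u] and [w] have opposite signs at [p], so it vanishes; pairing it with [u]
    contradicts [0 < u .* w]. *)
Lemma cone_transfer_dual u w p : 0 <= u .* u -> 0 <= w .* w -> 0 < u .* w ->
  0 < p .* p -> 0 < u .* p -> 0 < w .* p.
Proof.
move=> uu ww uw pp up; rewrite ltNge; apply/negP => wp.
have z0 : (u .* p) *: w - (w .* p) *: u = 0.
  apply: (lorJ p) => //; rewrite !mformE; last rewrite (mformC w u) //.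
    by rewrite (mformC p w) // (mformC p u) //; ring.
  have h1 := mulr_ge0 (sqr_ge0 (u .* p)) ww.
  have h2 := mulr_ge0 (sqr_ge0 (w .* p)) uu.
  have h3 := mulr_le0_ge0 wp (mulr_ge0 (ltW uw) (ltW up)).
  lra.
have := congr1 (mform J u) z0.
have h1 := mulr_gt0 up uw; have h2 := mulr_le0_ge0 wp uu.
by rewrite !mformE mform0r; lra.
Qed.

Lemma cauchy_schwarz_perp p u v : 0 < p .* p -> p .* u = 0 -> p .* v = 0 ->
  (u .* v) ^+ 2 <= u .* u * (v .* v).
Proof.
have neg x : 0 < p .* p -> p .* x = 0 -> x .* x <= 0.
  move=> pp px; rewrite leNgt; apply/negP => xx.
  by move: (xx); rewrite (lorJ p x) ?mform0l ?ltxx // ltW.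
move=> pp pu pv.
have [/eqP vv|vv] := eqVneq (v .* v) 0.
  by rewrite (lorJ p v) ?(eqP vv)// !(mformC u) // !mform0l expr0n mulr0.
have vv0 : v .* v < 0 by rewrite lt_neqAle vv neg.
have := neg ((v .* v) *: u - (u .* v) *: v) pp.
rewrite !mformE pu pv !mulr0 subrr (mformC v u) // => /(_ erefl) h.
by rewrite -subr_ge0 -(nmulr_rle0 _ vv0); apply: le_trans h; nra.
Qed.

(** Split [v] and [u] along [p] and its orthogonal complement. The component of
    [v] in the complement has norm [-2 - (v .* p)^2 / (p .* p)], which is
    bounded, and the form is negative definite there, so Cauchy-Schwarz bounds
    the pairing with the component of [u]. *)
Lemma bounded_pairing p u (M : R) : 0 < p .* p ->
  exists C, forall v, v .* v = -2 -> `|v .* p| <= M -> `|v .* u| <= C.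
Proof.
move=> pp; pose u' := u - (u .* p / (p .* p)) *: p.
have pu' : p .* u' = 0 by rewrite /u' !mformE (mformC u) //; field; exact: lt0r_neq0.
have uu : u' .* u' <= 0.
  rewrite leNgt; apply/negP => xx.
  by move: (xx); rewrite (lorJ p u') ?mform0l ?ltxx // ltW.
exists (1 + (2 + M ^+ 2 / (p .* p)) * - (u' .* u') + M * (`|u .* p| / (p .* p))).
move=> v vv vM.
pose t := v .* p / (p .* p); pose w := v - t *: p.
have pw : p .* w = 0 by rewrite /w /t !mformE (mformC v) //; field; exact: lt0r_neq0.
have ww : w .* w = -2 - (v .* p) ^+ 2 / (p .* p).
  by rewrite /w /t !mformE (mformC p v) // vv; field; exact: lt0r_neq0.
have vu : v .* u = w .* u' + v .* p * (u .* p / (p .* p)).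
  rewrite /u' /w /t !mformE (mformC p u) //; field; exact: lt0r_neq0.
have cs := cauchy_schwarz_perp p w u' pp pw pu'.
(* 1 + t^2 replaces the square root in the bound on |t|. *)
have wu : `|w .* u'| <= 1 + (w .* w) * (u' .* u').
  apply: (@le_trans _ _ (1 + `|w .* u'| ^+ 2)); last first.
    by rewrite lerD2l real_normK // num_real.
  by nra.
rewrite vu; apply: (le_trans (ler_normD _ _)); apply: lerD.
  apply: (le_trans wu); rewrite lerD2l ww.
  have sq : (v .* p) ^+ 2 / (p .* p) <= M ^+ 2 / (p .* p).
    rewrite ler_pM2r ?invr_gt0 // -(real_normK (num_real (v .* p))).
    by rewrite ler_pXn2r // nnegrE // (le_trans _ vM).
  by nra.
rewrite normrM normf_div (gtr0_norm pp); apply: ler_wpM2r => //.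
by rewrite divr_ge0 // ltW.
Qed.

End Lorentzian.

(** * Roots and the faces they cut out *)

Lemma bounded_int_argmin {R : realType} {k : nat} (P : set 'cV[int]_k)
    (F : 'cV[int]_k -> R) (N : nat) z0 : P z0 ->
  (forall z, P z -> forall i, `|z i 0| <= N%:Z) ->
  exists2 z, P z & forall z', P z' -> F z <= F z'.
Proof.
move=> Pz0 bd.
pose dec (f : {ffun 'I_k -> 'I_(N.*2.+1)}) : 'cV[int]_k :=
  \col_i ((f i)%:Z - N%:Z).
have dec_surj z : P z -> exists f, dec f = z.
  move=> Pz; exists [ffun i => inord (absz (z i 0 + N%:Z))].
  apply/colP => i; rewrite !mxE ffunE /=.
  by have ? := bd z Pz i; rewrite inordK; lia.
have [f0 f0E] := dec_surj _ Pz0.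
have Pf0 : [pred f | `[< P (dec f) >]] f0 by apply/asboolP; rewrite f0E.
case: (arg_minP (fun f => F (dec f)) Pf0) => f /asboolP Pf fmin.
exists (dec f) => // z' Pz'; have [f' f'E] := dec_surj _ Pz'.
by rewrite -f'E; apply: fmin; apply/asboolP; rewrite f'E.
Qed.

Section Roots.
Context {R : realType} {J : 'M[R]_4}.
Hypotheses (symJ : J^T = J) (lorJ : lorentzian J).
Implicit Types u v w x y p : 'cV[R]_4.
Local Notation "u .* v" := (mform J u v) (at level 40).

Lemma lorentzian_unit p : 0 < p .* p -> J \in unitmx.
Proof.
move=> pp; rewrite -row_free_unit; apply: inj_row_free => r rJ.
apply: trmx_inj; rewrite trmx0; apply: (lorJ p) => //.
  by rewrite mformC // /mform trmxK rJ mul0mx mxE.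
by rewrite /mform trmxK rJ mul0mx mxE.
Qed.

(** The coordinates of [v] are its pairings with the dual basis [u], so roots
    at bounded height over [p] lie in a box. *)
Lemma bounded_coord p (M : R) : 0 < p .* p ->
  exists N : nat, forall z : 'cV[int]_4, let v := map_mx intr z in
    v .* v = -2 -> `|v .* p| <= M -> forall i, `|z i 0| <= N%:Z.
Proof.
move=> pp; have uJ := lorentzian_unit p pp.
pose u i : 'cV[R]_4 := invmx J *m delta_mx i 0.
have uE v i : v .* u i = v i 0.
  rewrite /mform /u mulmxA mulmxK // mxE (bigD1 i) //= big1 => [|j /negPf ji].
    by rewrite !mxE !eqxx mulr1 addr0.
  by rewrite !mxE ji mulr0.
have /choice[C CP] i := bounded_pairing symJ lorJ p (u i) M pp.
exists (\max_i Num.bound (C i))%N => z v vv vM i.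
have := CP i v vv vM; rewrite uE mxE => h.
have : (`|z i 0|%:~R : R) < (Num.bound (C i))%:R.
  rewrite intr_norm; apply: le_lt_trans h _; apply: archi_boundP.
  exact: le_trans (CP i v vv vM).
rewrite -[_%:R]/((Num.bound (C i))%:Z%:~R) ltr_int => /ltW /le_trans; apply.
by rewrite lez_nat; apply: leq_bigmax.
Qed.

End Roots.

(** Two distinct planes with normals [v], [w] of norm -2 meet in hyperbolic space
    exactly when the absolute value of [mform J v w] is less than 2; at 2 they
    are tangent at infinity. *)
Definition noncrossing_roots {R : realType} (J : 'M[R]_4) : Prop :=
  forall v w, intlattice v -> intlattice w ->
    mform J v v = -2 -> mform J w w = -2 ->
    mform J v w <= -2 \/ 2 <= mform J v w.

Section Faces.
Context {R : realType} {J : 'M[R]_4} {D : 'cV[R]_4}.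
Hypotheses (symJ : J^T = J) (lorJ : lorentzian J).
Hypothesis upJ : noncrossing_roots J.
Hypothesis DD : 0 < mform J D D.
Implicit Types u v w x y p : 'cV[R]_4.
Local Notation "u .* v" := (mform J u v) (at level 40).
Local Notation E2 := (E2 J D).
Local Notation E2star := (E2star J D).

Lemma same_sheet x y w : 0 < x .* x -> 0 < x .* D -> 0 < y .* y -> 0 < y .* D ->
  0 <= w .* w -> 0 < w .* x -> 0 < w .* y.
Proof.
move=> xx xD yy yD ww wx; apply: (cone_transfer symJ lorJ D) => //.
  by rewrite mformC.
exact: (cone_transfer symJ lorJ x).
Qed.

Lemma nearest_root x v : E2 v -> v .* x < 0 ->
  exists v', [/\ E2 v', v' .* x < 0 &
    forall w, E2 w -> w .* x < 0 -> v' .* D <= w .* D].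
Proof.
move=> Ev vx; have [[z _ zE] vv vD] := Ev.
have [N NP] := bounded_coord symJ lorJ D (v .* D) DD.
pose P := [set z : 'cV[int]_4 | let u := map_mx intr z in
  [/\ E2 u, u .* x < 0 & u .* D <= v .* D]].
have Pz : P z by rewrite /P /= zE.
have [|z' [E' x' D'] zmin] := bounded_int_argmin P (fun z => map_mx intr z .* D) N z Pz.
  move=> y [[_ yy yD] _ yv]; apply: NP => //.
  by rewrite gtr0_norm.
exists (map_mx intr z'); split => // w Ew wx.
have [wv|/ltW vw] := leP (w .* D) (v .* D); last exact: le_trans vw.
have [[zw _ zwE] _ _] := Ew.
by rewrite -zwE; apply: zmin; rewrite /P /= zwE.
Qed.

(** Suppose [w] is negative at a point [y] of the wall of [v]. If [v .* w >= 2]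
    then [v + w] is causal and past directed, although it is positive at [D].
    If [v .* w <= -2] then [v - w] is causal and future directed, so [w] also
    separates [D] from [x] and is nearer to [D] than [v]. *)
Lemma nearest_root_wall x v : 0 < x .* x -> 0 < x .* D ->
  E2 v -> v .* x < 0 ->
  (forall w, E2 w -> w .* x < 0 -> v .* D <= w .* D) ->
  hplane J v `&` hyperboloid J D `<=` K2 J D.
Proof.
move=> xx xD Ev vx vmin y [vy [yy yD]] w Ew; rewrite /hspace /= leNgt.
apply/negP => wy; have [Lv vv vD] := Ev; have [Lw ww wD] := Ew.
move: vy; rewrite /hplane /= => vy.
have yy0 : 0 < y .* y by rewrite yy.
have [vw|vw] := upJ v w Lv Lw vv ww.
  have nn : 0 <= (v - w) .* (v - w).
    by rewrite !mformE (mformC w v) // vv ww; lra.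
  have ny : 0 < (v - w) .* y by rewrite !mformE vy; lra.
  have nx := same_sheet y x _ yy0 yD xx xD nn ny.
  have nD := same_sheet y D _ yy0 yD DD DD nn ny.
  move: nx nD; rewrite !mformE => nx nD.
  have wx : w .* x < 0 by lra.
  by have := vmin w Ew wx; lra.
have nn : 0 <= (- (v + w)) .* (- (v + w)).
  by rewrite !mformE (mformC w v) // vv ww; lra.
have ny : 0 < (- (v + w)) .* y by rewrite !mformE vy; lra.
by have := same_sheet y D _ yy0 yD DD DD nn ny; rewrite !mformE; lra.
Qed.

Lemma normalize_hyperboloid y : 0 < y .* y -> 0 < y .* D ->
  hyperboloid J D ((Num.sqrt (y .* y))^-1 *: y).
Proof.
move=> yy yD; have s0 : 0 < Num.sqrt (y .* y) by rewrite sqrtr_gt0.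
split; last by rewrite mformZl mulr_gt0 ?invr_gt0.
rewrite mformZl mformZr -{3}(sqr_sqrtr (ltW yy)).
by field; exact: lt0r_neq0.
Qed.

(** The whole plane of the nearest separating root lies in [K2], so its relative
    interior is everything and only a point of the plane has to be found: the
    one where the plane meets the segment from [D] to [x]. *)
Lemma exists_face x v : 0 < x .* x -> 0 < x .* D -> E2 v -> v .* x < 0 ->
  exists2 v', E2star v' & v' .* x < 0.
Proof.
move=> xx xD Ev vx; have [v' [Ev' vx' vmin]] := nearest_root x v Ev vx.
exists v' => //; split=> //.
have [_ _ vD'] := Ev'.
have wall := nearest_root_wall x v' xx xD Ev' vx' vmin.
pose y := (v' .* D) *: x - (v' .* x) *: D.
have yy : 0 < y .* y.
  have h1 := mulr_gt0 (exprn_gt0 2 vD') xx.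
  have h2 := mulr_ge0 (sqr_ge0 (v' .* x)) (ltW DD).
  have h3 := mulr_le0_ge0 (ltW vx') (mulr_ge0 (ltW vD') (ltW xD)).
  by rewrite /y !mformE (mformC D x) //; lra.
have yD : 0 < y .* D.
  have h1 := mulr_gt0 vD' xD.
  have h2 := mulr_le0_ge0 (ltW vx') (ltW DD).
  by rewrite /y !mformE; lra.
have Hy : (hplane J v' `&` hyperboloid J D) ((Num.sqrt (y .* y))^-1 *: y).
  by split; [rewrite /hplane /= !mformE; ring | exact: normalize_hyperboloid].
exists ((Num.sqrt (y .* y))^-1 *: y); split=> //.
apply: (@filterS _ _ _ (hplane J v' `&` hyperboloid J D)); last exact: withinT.
move=> q [vq Hq]; split=> //; split=> //; exact: wall.
Qed.

Lemma face_point v : is_face J D v ->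
  exists p, [/\ v .* p = 0, hyperboloid J D p & K2 J D p].
Proof.
by move=> [p [[vp Hp] /nbhs_singleton /(_ (conj vp Hp)) [[_ Kp] _]]]; exists p.
Qed.

(** If [v .* w <= -2], then [w - v] is causal, positive at a point [p] of the face
    of [v] and nonpositive at a point [q] of the face of [w], which is impossible
    on one sheet. Equality [w .* p = 0] forces [w = v]. *)
Lemma faces_separated v w : E2star v -> E2star w -> v <> w -> 2 <= v .* w.
Proof.
move=> [Ev /face_point[p [vp [pp pD] Kp]]] [Ew /face_point[q [wq [qq qD] Kq]]] vw.
have [[Lv vv vD] [Lw ww wD]] := (Ev, Ew).
have [c|//] := upJ v w Lv Lw vv ww.
have nn : 0 <= (w - v) .* (w - v).
  by rewrite !mformE (mformC w v) // vv ww; lra.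
have wp : 0 <= w .* p := Kp w Ew.
have vq : 0 <= v .* q := Kq v Ev.
have pp0 : 0 < p .* p by rewrite pp.
have qq0 : 0 < q .* q by rewrite qq.
have [wp0|wp0] := eqVneq (w .* p) 0.
  case: vw; apply/esym/subr0_eq; apply: (lorJ p) => //.
  by rewrite mformC // !mformE vp wp0; lra.
have np : 0 < (w - v) .* p by rewrite !mformE vp subr0 lt_def wp0.
by have := same_sheet p q _ pp0 pD qq0 qD nn np; rewrite !mformE wq; lra.
Qed.

End Faces.

(** * Maximality from root planes that cross every half space *)

(** Some root plane enters the open half space [m .* x < 0], with points of that
    half space on its negative side. *)
Definition roots_cross {R : realType} (J : 'M[R]_4) (D : 'cV[R]_4) : Prop :=
  forall m, mform J m m = -2 -> exists x v,
    [/\ 0 < mform J x x, 0 < mform J x D, mform J m x < 0,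
        E2 J D v & mform J v x < 0].

Section Maximality.
Context {R : realType} {J : 'M[R]_4} {D : 'cV[R]_4}.
Hypotheses (symJ : J^T = J) (lorJ : lorentzian J).
Hypothesis upJ : noncrossing_roots J.
Hypothesis DD : 0 < mform J D D.
Hypothesis crossJ : roots_cross J D.
Implicit Types u v w x y p m : 'cV[R]_4.
Local Notation "u .* v" := (mform J u v) (at level 40).
Local Notation E2 := (E2 J D).
Local Notation E2star := (E2star J D).

Lemma face_meets m : m .* m = -2 -> exists x v,
  [/\ 0 < x .* x, 0 < x .* D, m .* x < 0, E2star v & v .* x < 0].
Proof.
move=> mm; have [x [v [xx xD mx Ev vx]]] := crossJ m mm.
by have [w Ew wx] := exists_face symJ lorJ upJ DD x v xx xD Ev vx; exists x, w.
Qed.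

Lemma E2star_packing : is_packing J E2star.
Proof.
split; last first.
  move=> [v vE].
  have [_ _ vD] : E2 v by have [] : E2star v by rewrite vE; left.
  have [_ _] : E2 (- v) by have [] : E2star (- v) by rewrite vE; right.
  by rewrite mformNl; lra.
exists 2; split=> // [v [[_ ->]] //|v w Ev Ew].
exact: (faces_separated symJ lorJ upJ DD).
Qed.

(** The root [e] only shows that there is a face, which fixes the constant of the
    packing to be 2. The second face [w] comes from crossing the opposite half
    space of the first one. *)
Lemma E2star_maximal e : e .* e = -2 -> is_maximal_packing J E2star.
Proof.
move=> ee; split; first exact: E2star_packing.
move=> m mE [[k [k0 nk sk]] _].
have inP v : E2star v -> (E2star `|` [set m]) v by left.
have mP : (E2star `|` [set m]) m by right.
have E2star2 v : E2star v -> v .* v = -2 by case=> -[].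
have k2 : k = 2.
  have [x [v [_ _ _ Ev _]]] := face_meets e ee.
  by have := nk v (inP v Ev); rewrite E2star2 // => /oppr_inj.
have mm : m .* m = -2 by rewrite nk // k2.
have m2 v : E2star v -> 2 <= m .* v.
  by move=> Ev; rewrite -k2; apply: sk (inP v Ev) _ => // mv; apply: mE; rewrite mv.
have [x [v [xx xD mx Ev vx]]] := face_meets m mm.
have [|y [w [yy yD vy Ew wy]]] := face_meets (- v).
  by rewrite mformNl mformNr opprK E2star2.
have vw : v <> w by move=> vw; move: vy; rewrite mformNl vw; lra.
have vw2 := faces_separated symJ lorJ upJ DD v w Ev Ew vw.
have [mv mw] := (m2 v Ev, m2 w Ew).
have [vv ww] := (E2star2 v Ev, E2star2 w Ew).
have uu : 0 <= (v + w) .* (v + w).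
  by rewrite !mformE (mformC w v) // vv ww; lra.
have nn : 0 <= (m + v) .* (m + v).
  by rewrite !mformE (mformC v m) // vv mm; lra.
have un : 0 < (v + w) .* (m + v).
  by rewrite !mformE (mformC v m) // (mformC w v) // (mformC w m) // vv; lra.
have [[_ _ vD] _] := Ev; have [[_ _ wD] _] := Ew.
have uD : 0 < (v + w) .* D by rewrite mformDl addr_gt0.
have nD := cone_transfer_dual symJ lorJ (v + w) (m + v) D uu nn un DD uD.
have := same_sheet symJ lorJ DD D x (m + v) DD DD xx xD nn nD.
by rewrite mformDl; lra.
Qed.

End Maximality.

Lemma quadratic_eventually_gt0 {R : realType} (A B C : R) : 0 < C ->
  exists K : nat, forall k : nat, (K <= k)%N -> 0 < A + k%:R * B + k%:R ^+ 2 * C.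
Proof.
move=> C0; pose M := (`|A| + `|B|) / C.
exists (Num.bound M) => k Kk.
have M0 : 0 <= M by rewrite divr_ge0 ?addr_ge0 // ltW.
have kM : M < k%:R by rewrite (lt_le_trans (archi_boundP M0)) // ler_nat.
have k0 : (0 < k)%N by rewrite -(ltr_nat R) (le_lt_trans M0).
have k1 : 1 <= k%:R :> R by rewrite ler1n.
have kC : `|A| + `|B| < k%:R * C by rewrite -ltr_pdivrMr.
have A0 : - `|A| <= A by rewrite lerNl -normrN ler_norm.
have B0 : - `|B| <= B by rewrite lerNl -normrN ler_norm.
have h1 : 0 <= (k%:R - 1) * `|A| by rewrite mulr_ge0 ?subr_ge0.
have h2 : 0 <= k%:R * (B + `|B|) by rewrite mulr_ge0 //; lra.
have h3 : 0 < k%:R * (k%:R * C - (`|A| + `|B|)).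
  by rewrite mulr_gt0 ?subr_gt0 // (lt_le_trans ltr01).
lra.
Qed.

Section Lattice.
Context {R : realType}.
Implicit Types u v : 'cV[R]_4.

Lemma intlatticeD u v : intlattice u -> intlattice v -> intlattice (u + v).
Proof. by move=> [a _ <-] [b _ <-]; exists (a + b); rewrite ?map_mxD. Qed.

Lemma intlatticeN u : intlattice u -> intlattice (- u).
Proof. by move=> [a _ <-]; exists (- a); rewrite ?map_mxN. Qed.

Lemma intlatticeZ (k : int) u : intlattice u -> intlattice (k%:~R *: u).
Proof. by move=> [a _ <-]; exists (k *: a); rewrite ?map_mxZ. Qed.
End Lattice.

Definition even_form {R : realType} (J : 'M[R]_4) : Prop :=
  forall u v, intlattice u -> intlattice v ->
    exists z : int, mform J u v = 2 * z%:~R.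

(** The Eichler transvection attached to an isotropic [c] and to [k *: a] with
    [a] orthogonal to [c]. *)
Definition transvection {R : realType} (J : 'M[R]_4) (c a : 'cV[R]_4) (k : R)
    (x : 'cV[R]_4) : 'cV[R]_4 :=
  x + (k * mform J c x) *: a
    - (k * mform J a x + k ^+ 2 * (mform J a a / 2) * mform J c x) *: c.

Section Transvection.
Context {R : realType} {J : 'M[R]_4} {D : 'cV[R]_4}.
Hypothesis symJ : J^T = J.
Hypothesis evenJ : even_form J.
Hypothesis DE : forall v, intlattice v -> mform J v v = -2 -> mform J D v <> 0.
Implicit Types u v w x y p m : 'cV[R]_4.
Local Notation "u .* v" := (mform J u v) (at level 40).
Variables c a : 'cV[R]_4.
Hypotheses (cc : c .* c = 0) (ac : a .* c = 0).
Local Notation T := (transvection J c a).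

Lemma transvection_isometry k x y : T k x .* T k y = x .* y.
Proof.
rewrite /transvection !mformE (mformC x c) // (mformC x a) //.
by rewrite (mformC c a) // ac cc; field.
Qed.

Lemma transvection_lattice (k : nat) v : intlattice c -> intlattice a ->
  intlattice v -> intlattice (T k%:R v).
Proof.
move=> Lc La Lv.
have [z1 cv] := evenJ c v Lc Lv; have [z2 av] := evenJ a v La Lv.
have [z3 aa] := evenJ a a La La.
rewrite /transvection cv av aa.
have -> : k%:R * (2 * z1%:~R) = (k%:Z * (2 * z1))%:~R :> R by rewrite !intrM.
have -> : k%:R * (2 * z2%:~R) + k%:R ^+ 2 * (2 * z3%:~R / 2) * (2 * z1%:~R) =
   (k%:Z * (2 * z2) + k%:Z * k%:Z * z3 * (2 * z1))%:~R :> R.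
  by rewrite intrD !intrM; field.
by apply: intlatticeD; [apply: intlatticeD|apply: intlatticeN]; rewrite ?intlatticeZ //;
  apply: intlatticeZ.
Qed.

(** The leading term of [T k y] is [- k^2 (a .* a) / 2 * (c .* y)] times [c]. *)
Lemma transvection_attracts y u : a .* a < 0 -> 0 < c .* y -> 0 < c .* u ->
  exists K : nat, forall k : nat, (K <= k)%N -> 0 < T k%:R y .* u.
Proof.
move=> aa cy cu.
have C0 : 0 < (- (a .* a) / 2) * (c .* y * (c .* u)).
  by apply: mulr_gt0; [lra | exact: mulr_gt0].
have [K KP] := quadratic_eventually_gt0 (y .* u)
  (c .* y * (a .* u) - a .* y * (c .* u)) _ C0.
by exists K => k /KP; rewrite /transvection !mformE; congr (0 < _); field.
Qed.

(** The images under a large power of the transvection of two points on either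
    side of [e] both lie in the half space of [m] and on the sheet of [D]. Which
    of them is on the negative side of the element of [E2] depends on the sign
    of the image of [e] at [D]. *)
Lemma roots_cross_near_cusp e y1 y2 m :
  intlattice c -> intlattice a -> intlattice e -> a .* a < 0 -> e .* e = -2 ->
  0 < y1 .* y1 -> 0 < y2 .* y2 -> 0 < c .* y1 -> 0 < c .* y2 ->
  e .* y1 < 0 -> 0 < e .* y2 -> 0 < c .* D -> c .* m < 0 ->
  exists x v, [/\ 0 < x .* x, 0 < x .* D, m .* x < 0, E2 J D v & v .* x < 0].
Proof.
move=> Lc La Le aa ee y11 y22 cy1 cy2 ey1 ey2 cD cm.
have cm' : 0 < c .* (- m) by rewrite mformNr oppr_gt0.
have [K1 P1] := transvection_attracts y1 D aa cy1 cD.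
have [K2 P2] := transvection_attracts y2 D aa cy2 cD.
have [K3 P3] := transvection_attracts y1 (- m) aa cy1 cm'.
have [K4 P4] := transvection_attracts y2 (- m) aa cy2 cm'.
have [k [k1 k2 k3 k4]] : exists k, [/\ K1 <= k, K2 <= k, K3 <= k & K4 <= k]%N.
  by exists (K1 + K2 + K3 + K4)%N; clear; split; lia.
have {}P1 := P1 k k1; have {}P2 := P2 k k2.
have {}P3 := P3 k k3; have {}P4 := P4 k k4.
have Lv : intlattice (T k%:R e) by exact: transvection_lattice.
have vv : T k%:R e .* T k%:R e = -2 by rewrite transvection_isometry.
have /eqP := DE _ Lv vv; rewrite mformC // neq_lt => /orP[vD|vD].
  exists (T k%:R y2), (- T k%:R e); split=> //.
  - by rewrite transvection_isometry.
  - by rewrite mformC //; move: P4; rewrite mformNr oppr_gt0.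
  - split; [exact: intlatticeN|by rewrite mformNl mformNr opprK|].
    by rewrite mformNl oppr_gt0.
  - by rewrite mformNl transvection_isometry oppr_lt0.
exists (T k%:R y1), (T k%:R e); split=> //.
- by rewrite transvection_isometry.
- by rewrite mformC //; move: P3; rewrite mformNr oppr_gt0.
- by rewrite transvection_isometry.
Qed.

End Transvection.

Lemma roots_cross_opp {R : realType} (J : 'M[R]_4) (D : 'cV[R]_4) :
  roots_cross J (- D) -> roots_cross J D.
Proof.
move=> h m mm; have [|x [v [xx xD mx [Lv vv vD] vx]]] := h (- m).
  by rewrite mformNl mformNr opprK.
exists (- x), (- v).
rewrite !mformE !opprK in xD mx vD *; rewrite !oppr_gt0 in xD vD.
by split=> //; first rewrite oppr_gt0 //; split; rewrite ?mformE ?opprK ?oppr_gt0 //;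
  exact: intlatticeN.
Qed.

(** * The form J_n *)

Definition col4 {T : pzRingType} (x1 x2 x3 x4 : T) : 'cV[T]_4 :=
  \col_i nth 0 [:: x1; x2; x3; x4] i.

Lemma col4P {T : pzRingType} (v : 'cV[T]_4) :
  exists x1 x2 x3 x4, v = col4 x1 x2 x3 x4.
Proof.
pose x k := v (inord k) 0; exists (x 0%N), (x 1%N), (x 2%N), (x 3%N).
apply/colP => i; rewrite mxE -[in LHS](inord_val i).
by case: i => -[|[|[|[|]]]].
Qed.

Lemma map_col4 (R : realType) (x1 x2 x3 x4 : int) :
  map_mx intr (col4 x1 x2 x3 x4) =
  col4 x1%:~R x2%:~R x3%:~R x4%:~R :> 'cV[R]_4.
Proof. by apply/colP => i; rewrite !mxE; case: i => -[|[|[|[|]]]]. Qed.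

Section Jn.
Context {R : realType} {n : nat}.
Local Notation J := (Jmx R n).
Local Notation "u .* v" := (mform J u v) (at level 40).

Lemma col4_intlattice (x1 x2 x3 x4 : int) :
  intlattice (col4 x1%:~R x2%:~R x3%:~R x4%:~R : 'cV[R]_4).
Proof. by rewrite -map_col4; exists (col4 x1 x2 x3 x4). Qed.

Lemma intlatticeP (v : 'cV[R]_4) : intlattice v ->
  exists x1 x2 x3 x4 : int, v = col4 x1%:~R x2%:~R x3%:~R x4%:~R.
Proof.
move=> [z _ <-]; have [x1 [x2 [x3 [x4 ->]]]] := col4P z.
by exists x1, x2, x3, x4; rewrite map_col4.
Qed.

Lemma Jmx_sym : J^T = J.
Proof.
by apply/matrixP => i j; rewrite !mxE; case: i j => -[|[|[|[|]]]] ? // [] [|[|[|[|]]]].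
Qed.

Lemma mform_col4 x1 x2 x3 x4 y1 y2 y3 y4 :
  col4 x1 x2 x3 x4 .* col4 y1 y2 y3 y4 =
    2 * ((x1 + x2 + x3 + x4) * (y1 + y2 + y3 + y4))
    - 4 * (x1 * y1 + x2 * y2 + x3 * y3 + x4 * y4)
    + 4 * (n%:R - 1) * (x3 * y4 + x4 * y3).
Proof.
rewrite /mform mxE !big_ord_recl big_ord0 !mxE !big_ord_recl !big_ord0 !mxE /=.
ring.
Qed.

Lemma Jmx_even : even_form J.
Proof.
move=> u v /intlatticeP[x1 [x2 [x3 [x4 ->]]]] /intlatticeP[y1 [y2 [y3 [y4 ->]]]].
exists ((x1 + x2 + x3 + x4) * (y1 + y2 + y3 + y4)
    - 2 * (x1 * y1 + x2 * y2 + x3 * y3 + x4 * y4)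
    + 2 * (n%:Z - 1) * (x3 * y4 + x4 * y3)).
by rewrite mform_col4 !(intrD, intrM, intrB); ring.
Qed.

Lemma odd_of_odd_square (S M : int) : S * S = 2 * M - 1 ->
  exists t, S = 2 * t + 1.
Proof.
move=> h; have [t [e|e]] : exists t, S = 2 * t \/ S = 2 * t + 1.
  have := divz_eq S 2; have := ltz_pmod S (isT : 0 < 2 :> int).
  have := modz_ge0 S (isT : 2 != 0 :> int).
  by move=> ? ? ?; exists (S %/ 2)%Z; lia.
- exfalso; rewrite e in h.
  have h' : 4 * (t * t) = 2 * M - 1 by rewrite -h; ring.
  lia.
- by exists t.
Qed.

(** Modulo 4 the form on the lattice is twice the product of the coordinate sums,
    and a root has odd coordinate sum. *)
Lemma Jmx_mod4 u v : intlattice u -> intlattice v ->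
  u .* u = -2 -> v .* v = -2 -> exists z : int, u .* v = 4 * z%:~R + 2.
Proof.
move=> /intlatticeP[x1 [x2 [x3 [x4 ->]]]] /intlatticeP[y1 [y2 [y3 [y4 ->]]]].
rewrite !mform_col4.
pose sum4 (x1 x2 x3 x4 : int) := x1 + x2 + x3 + x4.
pose M (x1 x2 x3 x4 y1 y2 y3 y4 : int) :=
  x1 * y1 + x2 * y2 + x3 * y3 + x4 * y4 - (n%:Z - 1) * (x3 * y4 + x4 * y3).
have odd_sum (z1 z2 z3 z4 : int) :
    2 * ((z1%:~R + z2%:~R + z3%:~R + z4%:~R) * (z1%:~R + z2%:~R + z3%:~R + z4%:~R))
    - 4 * (z1%:~R * z1%:~R + z2%:~R * z2%:~R + z3%:~R * z3%:~R + z4%:~R * z4%:~R)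
    + 4 * (n%:R - 1) * (z3%:~R * z4%:~R + z4%:~R * z3%:~R) = -2 :> R ->
    exists t, sum4 z1 z2 z3 z4 = 2 * t + 1.
  move=> h; apply: (@odd_of_odd_square _ (M z1 z2 z3 z4 z1 z2 z3 z4)).
  apply: (@intr_inj R); rewrite /M /sum4 !(intrD, intrM, intrB) /=.
  by lra.
move=> /odd_sum[s sE] /odd_sum[t tE].
exists (2 * s * t + s + t - M x1 x2 x3 x4 y1 y2 y3 y4).
have st : sum4 x1 x2 x3 x4 * sum4 y1 y2 y3 y4 = (2 * s + 1) * (2 * t + 1).
  by rewrite sE tE.
move/(congr1 (fun z : int => z%:~R : R)): st.
rewrite /M /sum4 !(intrD, intrM, intrB) /=.
lra.
Qed.

Lemma Jmx_noncrossing : noncrossing_roots J.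
Proof.
move=> v w Lv Lw vv ww; have [z ->] := Jmx_mod4 v w Lv Lw vv ww.
have [z0|z0] := ltP z 0.
  by left; have : z%:~R <= (-1)%:~R :> R; [rewrite ler_int; lia | lra].
by right; have : 0%:~R <= z%:~R :> R; [rewrite ler_int | lra].
Qed.

Hypothesis n0 : (0 < n)%N.

Lemma n1 : 1 <= n%:R :> R.
Proof. by rewrite ler1n. Qed.

(** The form in light-cone coordinates is [a b - 2 d^2 - 2 N q^2]. The
    unprimed vector is timelike, the primed one is orthogonal to it and has norm
    at least 0. Lagrange's identity gives [4 ab a'b' <= (ab' + a'b)^2 <= 4 A A'],
    where [A] and [A'] are the definite parts; as [A < ab] and [A' <= a'b'], the
    primed vector is zero. *)
Lemma light_cone_signature (N a b d q a' b' d' q' : R) : 1 <= N ->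
  0 < a * b - 2 * d ^+ 2 - 2 * N * q ^+ 2 ->
  (a * b' + a' * b) / 2 - 2 * d * d' - 2 * N * q * q' = 0 ->
  0 <= a' * b' - 2 * d' ^+ 2 - 2 * N * q' ^+ 2 ->
  [/\ a' = 0, b' = 0, d' = 0 & q' = 0].
Proof.
move=> n1 pp px xx.
pose A := 2 * d ^+ 2 + 2 * N * q ^+ 2; pose A' := 2 * d' ^+ 2 + 2 * N * q' ^+ 2.
have N0 : 0 <= N by lra.
have N2 : 0 <= 2 * N by lra.
have A0 : 0 <= A by apply: addr_ge0; apply: mulr_ge0 => //; exact: sqr_ge0.
have A'0 : 0 <= A' by apply: addr_ge0; apply: mulr_ge0 => //; exact: sqr_ge0.
have ab : A < a * b by rewrite /A; lra.
have ab' : A' <= a' * b' by rewrite /A'; lra.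
have lag : 4 * A * A' - (a * b' + a' * b) ^+ 2 = 16 * N * (d * q' - q * d') ^+ 2.
  have -> : a * b' + a' * b = 4 * d * d' + 4 * N * q * q' by lra.
  by rewrite /A /A'; ring.
have s1 : 0 <= N * (d * q' - q * d') ^+ 2 by rewrite mulr_ge0 ?sqr_ge0.
have s2 : 0 <= (a * b' - a' * b) ^+ 2 := sqr_ge0 _.
have h1 : a * b * (a' * b') <= A * A' by lra.
have h2 : A * A' <= A * (a' * b') by exact: ler_wpM2l.
have ab'0 : a' * b' = 0.
  apply/eqP; rewrite eq_le (le_trans A'0 ab') andbT.
  have : (a * b - A) * (a' * b') <= 0 by lra.
  by rewrite pmulr_rle0 // subr_gt0.
have A'00 : A' = 0 by lra.
have d0 : d' ^+ 2 = 0.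
  have := mulr_ge0 N0 (sqr_ge0 q'); have := sqr_ge0 d'; move: A'00; rewrite /A'; lra.
have q0 : q' ^+ 2 = 0.
  have := mulr_ge0 (_ : 0 <= N - 1) (sqr_ge0 q'); have := sqr_ge0 q'.
  move: A'00; rewrite /A' d0 => ? ? h; have := h ltac:(lra); lra.
have {d0}d0 : d' = 0 by apply/eqP; rewrite -sqrf_eq0 d0.
have {q0}q0 : q' = 0 by apply/eqP; rewrite -sqrf_eq0 q0.
have ab0 : a * b' + a' * b = 0 by move: px; rewrite d0 q0; lra.
have abpos : 0 < a * b := le_lt_trans A0 ab.
have a'0 : a' = 0.
  apply/eqP; rewrite -sqrf_eq0 -(mulIr_eq0 _ (mulIf (lt0r_neq0 abpos))); apply/eqP.
  have -> : a' ^+ 2 * (a * b) = a * a' * (a * b' + a' * b) - a ^+ 2 * (a' * b') by ring.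
  by rewrite ab0 ab'0; ring.
split=> //; apply/eqP.
move: ab0; rewrite a'0 mul0r addr0 => /eqP; rewrite mulf_eq0.
by case/orP => // /eqP a0; move: abpos; rewrite a0 mul0r ltxx.
Qed.

Lemma Jmx_lorentzian : lorentzian J.
Proof.
move=> p x; have [p1 [p2 [p3 [p4 ->]]]] := col4P p.
have [x1 [x2 [x3 [x4 ->]]]] := col4P x.
have n1 := n1; set N := n%:R in n1.
(* e_1 + e_2 is isotropic, and [al] is proportional to the pairing with it. *)
pose al (u1 u2 u3 u4 : R) := u3 + u4.
pose be u1 u2 u3 u4 : R := 4 * (u1 + u2) + (2 * N - 2) * (u3 + u4).
have coordE u1 u2 u3 u4 v1 v2 v3 v4 : col4 u1 u2 u3 u4 .* col4 v1 v2 v3 v4 =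
    (al u1 u2 u3 u4 * be v1 v2 v3 v4 + al v1 v2 v3 v4 * be u1 u2 u3 u4) / 2
    - 2 * (u1 - u2) * (v1 - v2) - 2 * N * (u3 - u4) * (v3 - v4).
  by rewrite mform_col4 /al /be; field.
have normE u1 u2 u3 u4 : col4 u1 u2 u3 u4 .* col4 u1 u2 u3 u4 =
    al u1 u2 u3 u4 * be u1 u2 u3 u4 - 2 * (u1 - u2) ^+ 2 - 2 * N * (u3 - u4) ^+ 2.
  by rewrite coordE; field.
rewrite !normE coordE => pp px xx.
have [] := light_cone_signature _ _ _ _ _ _ _ _ _ n1 pp px xx.
rewrite /al /be => e1 e2 e3 e4.
have x12 : x1 + x2 = 0 by move: e2; rewrite e1; lra.
have -> : x1 = 0 by lra.
have -> : x2 = 0 by lra.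
have -> : x3 = 0 by lra.
have -> : x4 = 0 by lra.
by apply/colP => i; rewrite !mxE; case: i => -[|[|[|[|]]]].
Qed.

Lemma integer_above (d s : R) : d != 0 -> exists i : int, s < d * i%:~R.
Proof.
move=> d0; exists (sgz d * (Num.bound `|s / d|)%:Z).
rewrite intrM -sgrEz mulrA -[d * _]mulrC -normrEsg mulrC.
rewrite -ltr_pdivrMr ?normr_gt0 // (le_lt_trans _ (archi_boundP (normr_ge0 _))) //.
by rewrite normf_div ler_pM2r ?ler_norm // invr_gt0 normr_gt0.
Qed.

(** Up to the factor [k ^+ 2], the left-hand side is a quadratic polynomial in the
    rational point [(i / k, j / k)] of the plane at infinity; the hypothesis says
    that it vanishes on a circle of curvature [p] or, if [p = 0], on a line. In
    the case [0 < p] the point is taken within [1 / k] of the centre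
    [(d / p, q / p)], where the polynomial is [- 1 / p]; otherwise a point far
    away will do. *)
Lemma rational_point_in_disc (p s d q : R) :
  4 * s * p + (2 * n%:R - 2) * p ^+ 2 - 2 * d ^+ 2 - 2 * n%:R * q ^+ 2 = -2 ->
  exists i j k : int, 0 < k /\
    p * (i%:~R ^+ 2 + n%:R * j%:~R ^+ 2 + (n%:R - 1) * k%:~R ^+ 2)
    + 2 * s * k%:~R ^+ 2 - 2 * d * i%:~R * k%:~R
    - 2 * n%:R * q * j%:~R * k%:~R < 0.
Proof.
move=> norm2; have n1 := n1.
have [p0|p0|p0] := ltgtP p 0.
- have [K /(_ K (leqnn K))] := quadratic_eventually_gt0
    (- (p * (n%:R - 1) + 2 * s)) (2 * d) (- p) ltac:(lra).
  by move=> h; exists K%:Z, 0, 1; split=> //; lra.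
(* At distance at most 1 / k in both coordinates the polynomial exceeds its
   value at the centre by at most p (n + 1) / k ^ 2, and
   k > p (n + 1) makes this smaller than 1 / p. *)
- pose k := (Num.bound (p * (n%:R + 1))).+1.
  have kp : p * (n%:R + 1) < k%:R.
    have h0 : 0 <= p * (n%:R + 1) by rewrite mulr_ge0 ?ltW //; lra.
    by rewrite (lt_trans (archi_boundP h0)) // ltr_nat.
  have near_floor (x : R) : `|(Num.floor x)%:~R - x| <= 1.
    by have := floor_itv x; rewrite intrD ler_norml => /andP[? ?]; lra.
  have sq (x : R) : `|x| <= 1 -> x ^+ 2 <= 1 :> R.
    by move=> x1; rewrite -real_normK ?num_real // expr_le1.
  pose i := Num.floor (k%:R * (d / p)); pose j := Num.floor (k%:R * (q / p)).
  exists i, j, k%:Z; split=> //.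
  have si := sq _ (near_floor (k%:R * (d / p))).
  have sj := sq _ (near_floor (k%:R * (q / p))).
  rewrite -/i -/j in si sj.
  have -> : p * (i%:~R ^+ 2 + n%:R * j%:~R ^+ 2 + (n%:R - 1) * k%:~R ^+ 2)
    + 2 * s * k%:~R ^+ 2 - 2 * d * i%:~R * k%:~R
    - 2 * n%:R * q * j%:~R * k%:~R =
    p * ((i%:~R - k%:R * (d / p)) ^+ 2 + n%:R * (j%:~R - k%:R * (q / p)) ^+ 2)
    - k%:R ^+ 2 / p.
    have -> : s = (- 2 - (2 * n%:R - 2) * p ^+ 2 + 2 * d ^+ 2 + 2 * n%:R * q ^+ 2) / (4 * p).
      have p4 : 4 * p != 0 by lra.
      apply: (mulIf p4); rewrite divfK //; lra.
    by field; lra.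
  rewrite subr_lt0 ltr_pdivlMr //.
  have h1 : n%:R * (j%:~R - k%:R * (q / p)) ^+ 2 <= n%:R * 1 by rewrite ler_pM2l //; lra.
  apply: (@le_lt_trans _ _ ((p * (n%:R + 1)) ^+ 2)).
    have -> : (p * (n%:R + 1)) ^+ 2 = p * ((n%:R + 1) ^+ 2) * p by ring.
    rewrite ler_pM2r // ler_pM2l //; nra.
  by rewrite ltr_pXn2r // ?nnegrE //; nra.
rewrite p0 in norm2 *.
have [d0|d0] := eqVneq d 0.
  have q0 : 2 * n%:R * q != 0.
    apply/eqP => q0.
    have nq2 : 2 * n%:R * q ^+ 2 = 0 by rewrite expr2 mulrA q0 mul0r.
    by move: norm2; rewrite d0; lra.
  have [j jP] := integer_above _ (2 * s) q0.
  by exists 0, j, 1; split=> //; rewrite d0; lra.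
have d2 : 2 * d != 0 by lra.
have [i iP] := integer_above _ (2 * s) d2.
by exists i, 0, 1; split=> //; lra.
Qed.

(** [c] is the isotropic lattice vector over the rational point [(i / k, j / k)],
    and [a] is half of its derivative in [i]. The root [e1] has the two
    timelike vectors [(3,0,1,1)] and [(1,0,1,1)] on its two sides. *)
Lemma Jmx_roots_cross_sheet D : 0 < D .* D -> 0 < col4 3 0 1 1 .* D ->
  (forall v, intlattice v -> v .* v = -2 -> D .* v <> 0) ->
  roots_cross J D.
Proof.
move=> DD yD DE m; have [m1 [m2 [m3 [m4 ->]]]] := col4P m.
have n1 := n1.
rewrite mform_col4 => mm.
have [|i [j [k [k0 neg]]]] := rational_point_in_disc (m3 + m4) (m1 + m2) (m1 - m2) (m3 - m4).
  by lra.
have kR : 0 < k%:~R ^+ 2 :> R by rewrite exprn_gt0 // ltr0z.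
pose e : int := i ^+ 2 + n%:Z * j ^+ 2 - (n%:Z - 1) * k ^+ 2.
pose c : 'cV[R]_4 := col4 (e + 2 * i * k)%:~R (e - 2 * i * k)%:~R
  (2 * (k ^+ 2 + j * k))%:~R (2 * (k ^+ 2 - j * k))%:~R.
pose a : 'cV[R]_4 := col4 (i + k)%:~R (i - k)%:~R 0%:~R 0%:~R.
pose e1 : 'cV[R]_4 := col4 1%:~R 0%:~R 0%:~R 0%:~R.
have cE := (intrD, intrM, mulrNz, expr2).
have cc : c .* c = 0 by rewrite mform_col4 /e !cE; ring.
have ac : a .* c = 0 by rewrite mform_col4 /e !cE; ring.
have aa : a .* a = - 8 * k%:~R ^+ 2 by rewrite mform_col4 !cE; ring.
have nk : 0 <= (n%:R - 1) * k%:~R ^+ 2 :> R.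
  by apply: mulr_ge0; [lra | exact: ltW].
have nj : 0 <= n%:R * j%:~R ^+ 2 :> R by apply: mulr_ge0; [lra | exact: sqr_ge0].
have cy : 0 < c .* col4 3 0 1 1.
  have -> : c .* col4 3 0 1 1 = 8 * (i%:~R - 3 / 2 * k%:~R) ^+ 2 + 6 * k%:~R ^+ 2
      + 8 * ((n%:R - 1) * k%:~R ^+ 2) + 8 * (n%:R * j%:~R ^+ 2).
    by rewrite mform_col4 /e !cE; field.
  by have := sqr_ge0 (i%:~R - 3 / 2 * k%:~R : R); lra.
have cy' : 0 < c .* col4 1 0 1 1.
  have -> : c .* col4 1 0 1 1 = 8 * (i%:~R - 1 / 2 * k%:~R) ^+ 2 + 6 * k%:~R ^+ 2
      + 8 * ((n%:R - 1) * k%:~R ^+ 2) + 8 * (n%:R * j%:~R ^+ 2).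
    by rewrite mform_col4 /e !cE; field.
  by have := sqr_ge0 (i%:~R - 1 / 2 * k%:~R : R); lra.
have cm : c .* col4 m1 m2 m3 m4 < 0.
  rewrite mform_col4 /e !cE; move: neg; rewrite !expr2; lra.
have yy : 0 < col4 3 0 1 1 .* col4 3 0 1 1 by rewrite mform_col4; lra.
apply: (roots_cross_near_cusp Jmx_sym Jmx_even DE c a cc ac e1 (col4 3 0 1 1) (col4 1 0 1 1)) => //.
- exact: col4_intlattice.
- exact: col4_intlattice.
- exact: col4_intlattice.
- by rewrite aa; lra.
- by rewrite mform_col4; lra.
- by rewrite mform_col4; lra.
- by rewrite mform_col4; lra.
- by rewrite mform_col4; lra.
- by apply: (cone_transfer Jmx_sym Jmx_lorentzian (col4 3 0 1 1)) => //; rewrite cc.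
Qed.

(** [D] may lie on either sheet; negating both [D] and [m] exchanges them. *)
Lemma Jmx_roots_cross D : 0 < D .* D ->
  (forall v, intlattice v -> v .* v = -2 -> D .* v <> 0) ->
  roots_cross J D.
Proof.
move=> DD DE; pose y : 'cV[R]_4 := col4 3 0 1 1.
have n1 := n1.
have yy : 0 < y .* y by rewrite mform_col4; lra.
have [yD|yD|yD] := ltgtP (y .* D) 0.
- apply: roots_cross_opp; apply: Jmx_roots_cross_sheet.
  + by rewrite mformNl mformNr opprK.
  + by rewrite mformNr oppr_gt0.
  + by move=> v Lv vv /eqP; rewrite mformNl oppr_eq0 => /eqP; exact: DE.
- exact: Jmx_roots_cross_sheet.
- have D0 := Jmx_lorentzian y D yy yD (ltW DD).
  by move: DD; rewrite D0 mform0l ltxx.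
Qed.

End Jn.

Theorem theorem2p1 (R : realType) (n : nat) (hn : (0 < n)%N)
  (D : 'cV[R]_4)
  (hD : 0 < mform (Jmx R n) D D)
  (hDv : forall v : 'cV[R]_4, intlattice v ->
     mform (Jmx R n) v v = -2 -> mform (Jmx R n) D v <> 0) :
  is_maximal_packing (Jmx R n) (E2star (Jmx R n) D).
Proof.
have lorJ := @Jmx_lorentzian R n hn.
have crossJ := Jmx_roots_cross hn D hD hDv.
have upJ := @Jmx_noncrossing R n.
have e1 : mform (Jmx R n) (col4 1 0 0 0) (col4 1 0 0 0) = -2.
  by rewrite mform_col4; lra.
exact: (E2star_maximal Jmx_sym lorJ upJ hD crossJ _ e1).
Qed.
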